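(* Let $H=(V,E,C,\ell)$ be an edge-colored hypergraph with $k=|C|$ colors and nonnegative edge weights $w$, and let $\{x_e\}_{e\in E}$ be an optimal solution of $\text{LP}_\text{VC}$ that is half-integral ($x_e\in\{0,1/2,1\}$ for all $e$). Let $E^1=\{e:x_e=1\}$, $E^{1/2}=\{e:x_e=1/2\}$, let $i^*\in\arg\max_{i\in C} w(E_i\cap E^{1/2})$, and let $Y=E^1\cup(E^{1/2}\setminus (E_{i^*}\cap E^{1/2}))$. Then $E\setminus Y$ contains no bad edge pair (so nodes can be colored so that every edge in $E\setminus Y$ is satisfied), and $w(Y)\le (2-\tfrac{2}{k})\,\mathrm{OPT}$, where $\mathrm{OPT}$ is the optimal value of \textsc{MinECC} on $H$. That is, this rounding procedure is a $(2-\tfrac2k)$-approximation for \textsc{MinECC}.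
   Context: An edge-colored hypergraph $H=(V,E,C,\ell)$ has node set $V$, hyperedge set $E$, color set $C=\{1,\dots,k\}$, and color map $\ell:E\to C$; $E_i=\{e\in E:\ell(e)=i\}$; weights $w(e)\ge0$ and $w(A)=\sum_{e\in A}w(e)$. In \textsc{MinECC} one assigns each node a color; a hyperedge $e$ is satisfied if all its nodes receive color $\ell(e)$; the goal is to minimize the total weight of unsatisfied edges. A pair $(e,f)$ of hyperedges is a bad edge pair if $e\cap f\neq\emptyset$ and $\ell(e)\ne\ell(f)$; $\mathcal{B}$ is the set of bad edge pairs. $\text{LP}_\text{VC}$ is the linear program: minimize $\sum_{e\in E}w(e)x_e$ subject to $x_e+x_f\ge1$ for all $(e,f)\in\mathcal{B}$ and $x_e\ge0$ for all $e\in E$. *)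

(* Defs.v *)
From mathcomp Require Import all_boot all_order all_algebra.

Set Implicit Arguments.
Unset Strict Implicit.
Unset Printing Implicit Defensive.

Import Order.TTheory GRing.Theory Num.Theory.
Local Open Scope ring_scope.

(* Hyperedges are indexed by a finite type, so that parallel hyperedges
   (equal node sets, possibly with distinct colors) are allowed. *)
Record hypergraph (k : nat) := Hypergraph {
  node : finType;
  edge : finType;
  nodes : edge -> {set node};
  color : edge -> 'I_k
}.

Section EdgeColoredClustering.

Variables (R : realFieldType) (k : nat) (H : hypergraph k).
Implicit Types (e f : edge H) (i : 'I_k) (A : {set edge H}).
Implicit Types (w x : edge H -> R) (c : {ffun node H -> 'I_k}).

Definition weight w A : R := \sum_(e in A) w e.

Definition color_class i : {set edge H} := [set e | color e == i].

Definition bad_pair e f : bool :=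
  (nodes e :&: nodes f != set0) && (color e != color f).

Definition satisfied c e : bool := [forall v in nodes e, c v == color e].

Definition cost w c : R := weight w [set e | ~~ satisfied c e].

(* The default value weight w setT is an upper bound of every cost when w is
   nonnegative, so this is the minimum of cost w as soon as colorings exist
   (lemma minECC_opt_min). *)
Definition minECC_opt w : R :=
  \big[Num.min/weight w setT]_(c : {ffun node H -> 'I_k}) cost w c.

Definition lpvc_feasible x : Prop :=
  (forall e f, bad_pair e f -> 1 <= x e + x f) /\ (forall e, 0 <= x e).

Definition lpvc_value w x : R := \sum_(e : edge H) w e * x e.

Definition lpvc_optimal w x : Prop :=
  lpvc_feasible x /\
  (forall y : edge H -> R, lpvc_feasible y -> lpvc_value w x <= lpvc_value w y).

Definition half_integral x : Prop :=
  forall e, [\/ x e = 0, x e = 1 / 2 | x e = 1].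

Definition E_one x : {set edge H} := [set e | x e == 1].

Definition E_half x : {set edge H} := [set e | x e == 1 / 2].

Definition rounded x i : {set edge H} :=
  E_one x :|: (E_half x :\: (color_class i :&: E_half x)).

Lemma minECC_opt_min w : (0 < k)%N -> (forall e, 0 <= w e) ->
  (exists c, cost w c = minECC_opt w) /\ (forall c, minECC_opt w <= cost w c).
Proof.
move=> k_gt0 w_ge0.
have lb c : minECC_opt w <= cost w c.
  by rewrite /minECC_opt (bigD1 c) //= ge_min lexx.
split=> //; pose c0 : {ffun node H -> 'I_k} := [ffun=> Ordinal k_gt0].
have [c _ c_min] := @Order.TotalTheory.arg_minP _ R _ c0 xpredT (cost w) isT.
exists c; apply/eqP; rewrite eq_le lb andbT /minECC_opt.
apply: (big_ind (fun t => cost w c <= t)) => [|a b ha hb|c' _]; last exact: c_min.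
- rewrite /cost /weight [leRHS](bigID (mem [set e | ~~ satisfied c e])) /=.
  under [X in _ <= X + _]eq_bigl do rewrite in_setT.
  by rewrite lerDl sumr_ge0.
- by rewrite le_min ha.
Qed.

End EdgeColoredClustering.

(* Main.v *)
Require Import Defs.
From mathcomp Require Import all_boot all_order all_algebra.
From mathcomp Require Import lra.

Set Implicit Arguments.
Unset Strict Implicit.
Unset Printing Implicit Defensive.

Import Order.TTheory GRing.Theory Num.Theory.
Local Open Scope ring_scope.

(** The indicator of the unsatisfied edges of a coloring is feasible for the
    vertex cover LP, so w(E^1) + w(E^{1/2}) / 2, the value of the half-integral
    optimum, is at most OPT. The heaviest color class carries at least a
    fraction 1/k of w(E^{1/2}), hence
    w(Y) <= w(E^1) + (1 - 1/k) w(E^{1/2}), and w(E^1) <= (2 - 2/k) w(E^1)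
    when k >= 2. When k = 1 there are no bad pairs, so the LP optimum is 0. *)

Section Rounding.

Variables (R : realFieldType) (k : nat) (H : hypergraph k).
Implicit Types (e f : edge H) (i : 'I_k) (A B : {set edge H}).
Implicit Types (w x : edge H -> R) (c : {ffun node H -> 'I_k}).

Lemma weight_ge0 w A : (forall e, 0 <= w e) -> 0 <= weight w A.
Proof. by move=> w_ge0; apply: sumr_ge0. Qed.

Lemma weight_subset w A B :
  (forall e, 0 <= w e) -> A \subset B -> weight w A <= weight w B.
Proof.
move=> w_ge0 sAB; rewrite /weight [leRHS](big_setID A) /= (setIidPr sAB).
by rewrite lerDl sumr_ge0.
Qed.

Lemma weight_color_classes w A :
  weight w A = \sum_i weight w (color_class H i :&: A).
Proof.
rewrite /weight (partition_big (@color k H) xpredT) //=.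
by apply: eq_bigr => i _; apply: eq_bigl => e; rewrite !inE andbC.
Qed.

(** A node shared by [e] and [f] cannot carry both colors. Hence every coloring leaves an edge of
    each bad pair unsatisfied, which is the covering constraint of the LP. *)
Lemma bad_pair_satisfied c e f :
  bad_pair e f -> satisfied c e -> ~~ satisfied c f.
Proof.
case/andP=> /set0Pn[v /setIP[ve vf]] nef /forall_inP se.
apply: contraNN nef => /forall_inP sf.
by rewrite -(eqP (se v ve)) (sf v vf).
Qed.

Lemma unsatisfied_feasible c :
  lpvc_feasible (fun e => (~~ satisfied c e)%:R : R).
Proof.
split=> [e f bef|e]; last exact: ler0n.
rewrite -natrD ler1n; case se: (satisfied c e) => //=.
by rewrite (bad_pair_satisfied bef se).
Qed.

Lemma lpvc_value_unsatisfied w c :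
  lpvc_value w (fun e => (~~ satisfied c e)%:R) = cost w c.
Proof.
rewrite /lpvc_value /cost /weight [RHS]big_mkcond /=.
by apply: eq_bigr => e _; rewrite inE; case: satisfied; rewrite ?mulr0 ?mulr1.
Qed.

Lemma lpvc_optimal_le_cost w x c :
  lpvc_optimal w x -> lpvc_value w x <= cost w c.
Proof.
case=> _ x_min; rewrite -lpvc_value_unsatisfied.
exact/x_min/unsatisfied_feasible.
Qed.

Lemma lpvc_value_half_integral w x : half_integral x ->
  lpvc_value w x = weight w (E_one x) + weight w (E_half x) / 2.
Proof.
move=> x_half; rewrite /lpvc_value /weight mulr_suml.
rewrite [X in X + _]big_mkcond [X in _ + X]big_mkcond /= -big_split /=.
apply: eq_bigr => e _; rewrite !inE.
have [-> | -> | ->] := x_half e.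
- have /negPf-> : 0 != 1 :> R by apply/eqP; lra.
  have /negPf-> : 0 != 1 / 2 :> R by apply/eqP; lra.
  by rewrite mulr0 addr0.
- have /negPf-> : 1 / 2 != 1 :> R by apply/eqP; lra.
  by rewrite eqxx add0r mul1r.
- have /negPf-> : 1 != 1 / 2 :> R by apply/eqP; lra.
  by rewrite eqxx addr0 mulr1.
Qed.

Lemma notin_rounded x i e : half_integral x -> e \notin rounded x i ->
  x e = 0 \/ x e = 1 / 2 /\ color e = i.
Proof.
move=> x_half; rewrite !inE negb_or => /andP[/eqP x_neq1].
have [-> | xe | //] := x_half e; first by left.
by rewrite xe eqxx !andbT negbK => /eqP; right.
Qed.

(** Edges left out of the rounded set have value at most 1/2, so the covering constraint of a bad
    pair would force both values to be 1/2. Both edges then have color [i], and a bad pair needs two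
    colors. *)
Lemma rounded_no_bad_pair x i e f : lpvc_feasible x -> half_integral x ->
  e \notin rounded x i -> f \notin rounded x i -> ~~ bad_pair e f.
Proof.
move=> [cov _] x_half eY fY; apply/negP => bef; have := cov _ _ bef.
case: (notin_rounded x_half eY) => [->|[-> ce]];
  case: (notin_rounded x_half fY) => [->|[-> cf]]; try lra.
by case/andP: bef => _; rewrite ce cf eqxx.
Qed.

(** Each node copies the color of some edge of [A] through it; without bad pairs all such edges
    agree, so the choice is harmless. The color [i] only serves nodes that no edge of [A]
    contains. *)
Lemma satisfying_coloring i A :
  (forall e f, e \in A -> f \in A -> ~~ bad_pair e f) ->
  exists c, forall e, e \in A -> satisfied c e.
Proof.
move=> no_bad.
exists [ffun v => if [pick e in A | v \in nodes e] is Some e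
                  then color e else i].
move=> e eA; apply/forall_inP => v ve; rewrite ffunE.
case: pickP => [f /andP[fA vf]|/(_ e)]; last by rewrite eA ve.
apply: contraNT (no_bad f e fA eA) => nfe; rewrite /bad_pair nfe andbT.
by apply/set0Pn; exists v; rewrite inE vf.
Qed.

(** The rounded set and the spared color class partition the edges of value 1 or 1/2. *)
Lemma weight_rounded w x i :
  weight w (rounded x i) + weight w (color_class H i :&: E_half x)
  = weight w (E_one x) + weight w (E_half x).
Proof.
have dis : [disjoint E_one x & E_half x :\: (color_class H i :&: E_half x)].
  rewrite -setI_eq0; apply/eqP/setP => e; rewrite !inE.
  have one_neq_half : 1 != 1 / 2 :> R by apply/eqP; lra.
  by case: eqP => //= ->; rewrite (negPf one_neq_half) !andbF.
rewrite /weight /rounded (eq_bigl _ _ (fun e => in_setU e _ _)) bigU //=.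
rewrite -addrA; congr (_ + _).
rewrite [RHS](big_setID (color_class H i :&: E_half x)) /= addrC.
by rewrite (setIidPr (subsetIr _ _)).
Qed.

Lemma weight_E_half_le w x i :
  (forall j, weight w (color_class H j :&: E_half x)
             <= weight w (color_class H i :&: E_half x)) ->
  weight w (E_half x) <= k%:R * weight w (color_class H i :&: E_half x).
Proof.
move=> i_max; rewrite weight_color_classes.
apply: le_trans (ler_sum _ (fun j _ => i_max j)) _.
by rewrite sumr_const card_ord mulr_natl.
Qed.

Lemma lpvc_optimal_one_color w x :
  (k <= 1)%N -> lpvc_optimal w x -> lpvc_value w x <= 0.
Proof.
move=> k_le1 [_ x_min]; have zero_feasible : @lpvc_feasible R k H (fun=> 0).
  have ord_eq0 (j : 'I_k) : j = 0%N :> nat.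
    by apply/eqP; rewrite -leqn0 -ltnS (leq_trans (ltn_ord j)).
  split=> // e f /andP[_ /negP[]].
  by apply/eqP/ord_inj; rewrite !ord_eq0.
apply: le_trans (x_min _ zero_feasible) _.
by rewrite /lpvc_value big1 // => e _; rewrite mulr0.
Qed.

Lemma weight_rounded_le_lpvc w x i : (forall e, 0 <= w e) ->
  lpvc_optimal w x -> half_integral x ->
  (forall j, weight w (color_class H j :&: E_half x)
             <= weight w (color_class H i :&: E_half x)) ->
  weight w (rounded x i) <= (2 - 2 / k%:R) * lpvc_value w x.
Proof.
move=> w_ge0 x_opt x_half i_max.
have k_gt0 : (0 < k)%N by apply: leq_ltn_trans (ltn_ord i).
have kR_gt0 : 0 < k%:R :> R by rewrite ltr0n.
have wY := weight_rounded w x i.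
have := weight_E_half_le i_max; rewrite -ler_pdivrMl // => wH_le.
have w1_ge0 := weight_ge0 (E_one x) w_ge0.
have wH_ge0 := weight_ge0 (E_half x) w_ge0.
have val := lpvc_value_half_integral w x_half.
(* The half-integral edges contribute at most (1 - 1/k) w(E^{1/2}) to both sides, so only w(E^1) <=
   (2 - 2/k) w(E^1) is left. *)
suff w1_le : (2 / k%:R - 1) * weight w (E_one x) <= 0 by rewrite val; lra.
(* For k = 1 the factor 2/k - 1 is positive, so w(E^1) itself has to vanish; for k >= 2 the factor
   is at most 0. *)
have [k_le1 | k_gt1] := leqP k 1.
  have := lpvc_optimal_one_color k_le1 x_opt; rewrite val => val_le0.
  have -> : weight w (E_one x) = 0 by lra.
  by rewrite mulr0.
by rewrite mulr_le0_ge0 // subr_le0 ler_pdivrMr // mul1r ler_nat.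
Qed.

End Rounding.

Theorem theorem2 (R : realFieldType) (k : nat) (H : hypergraph k)
    (w : edge H -> R) (w_ge0 : forall e, 0 <= w e)
    (x : edge H -> R) (x_opt : lpvc_optimal w x) (x_half : half_integral x)
    (istar : 'I_k)
    (istar_max : forall i : 'I_k,
       weight w (color_class H i :&: E_half x)
         <= weight w (color_class H istar :&: E_half x)) :
  let Y := rounded x istar in
  [/\ forall e f, e \in ~: Y -> f \in ~: Y -> ~~ bad_pair e f,
      exists c : {ffun node H -> 'I_k}, forall e, e \in ~: Y -> satisfied c e,
      weight w Y <= (2 - 2 / k%:R) * minECC_opt w
    & forall c : {ffun node H -> 'I_k},
        (forall e, e \in ~: Y -> satisfied c e) ->
        cost w c <= (2 - 2 / k%:R) * minECC_opt w].
Proof.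
move=> Y.
have k_gt0 : (0 < k)%N by apply: leq_ltn_trans (ltn_ord istar).
have no_bad e f : e \in ~: Y -> f \in ~: Y -> ~~ bad_pair e f.
  by rewrite !in_setC; apply: rounded_no_bad_pair => //; case: x_opt.
have wY_le : weight w Y <= (2 - 2 / k%:R) * minECC_opt w.
  apply: le_trans (weight_rounded_le_lpvc w_ge0 x_opt x_half istar_max) _.
  (* OPT is attained by a coloring [c], whose cost bounds the LP optimum from above; the factor 2 -
     2/k is nonnegative as k >= 1. *)
  have [[c <-] _] := minECC_opt_min k_gt0 w_ge0.
  apply: ler_wpM2l; last exact: lpvc_optimal_le_cost.
  by rewrite subr_ge0 ler_pdivrMr ?ltr0n // ler_peMr ?ler1n.
split=> //; first exact: satisfying_coloring istar _ no_bad.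
move=> c sat_c; apply: le_trans wY_le; apply: weight_subset => //.
(* All edges that [c] leaves unsatisfied lie in [Y]. *)
apply/subsetP => e; rewrite inE; apply: contraNT => eY.
by apply: sat_c; rewrite in_setC.
Qed.
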